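(* Let $k,n\geq 0$ and let $p_1,\dots,p_{k+1},q,q_1,\dots,q_n$ be propositional symbols. The following equivalences hold: (i) ${=}(p_1\dots p_{k+1};q)\equiv (p_{k+1}\wedge{=}(p_1\dots p_k;q))\vee(\neg p_{k+1}\wedge{=}(p_1\dots p_k;q))$; (ii) $p_1\dots p_{k+1}\Upsilon q\equiv(p_{k+1}\wedge p_1\dots p_k\Upsilon q)\vee(\neg p_{k+1}\wedge p_1\dots p_k\Upsilon q)$; (iii) $p_1\dots p_k\perp_{p_{k+1}}q_1\dots q_n\equiv(p_{k+1}\wedge p_1\dots p_k\perp q_1\dots q_n)\vee(\neg p_{k+1}\wedge p_1\dots p_k\perp q_1\dots q_n)$; (iv) $p_1\dots p_{k+1}\perp q_1\dots q_n\equiv p_{k+1}\perp q_1\dots q_n\wedge\big((p_{k+1}\wedge p_1\dots p_k\perp q_1\dots q_n)\vee(\neg p_{k+1}\wedge p_1\dots p_k\perp q_1\dots q_n)\big)$.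
   Context: A team $T$ over a finite set $V=\mathrm{Var}(T)$ of propositional symbols is a set of evaluations $s:V\to\{0,1\}$. For $\bar p=p_1\dots p_k$, $s(\bar p)=s(p_1)\dots s(p_k)$. Team semantics: $T\models p$ iff $s(p)=1$ for all $s\in T$; $T\models\neg p$ iff $s(p)=0$ for all $s\in T$; $T\models\phi\wedge\psi$ iff $T\models\phi$ and $T\models\psi$; $T\models\phi\vee\psi$ iff there are $S,S'\subseteq T$ with $S\cup S'=T$, $S\models\phi$, $S'\models\psi$. Atoms: dependence: $T\models{=}(\bar p;q)$ iff for all $s,s'\in T$ with $s(\bar p)=s'(\bar p)$, $s(q)=s'(q)$; anonymity: $T\models\bar p\Upsilon q$ iff for all $s\in T$ there is $s'\in T$ with $s(\bar p)=s'(\bar p)$ and $s(q)\neq s'(q)$; conditional independence: $T\models\bar q\perp_{\bar p}\bar r$ iff for all $s,s'\in T$ with $s(\bar p)=s'(\bar p)$ there is $s''\in T$ with $s''(\bar p)=s(\bar p)$, $s''(\bar q)=s(\bar q)$ and $s''(\bar r)=s'(\bar r)$; $\bar q\perp\bar r$ denotes $\bar q\perp_{\bar p}\bar r$ with $\bar p$ the empty sequence. $\phi\equiv\psi$ means that $\phi,\psi$ have the same free symbols and $T\models\phi\iff T\models\psi$ for every team $T$ whose domain contains these symbols. *)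

(* Defs.v *)
From mathcomp Require Import all_boot finmap.

Set Implicit Arguments.
Unset Strict Implicit.
Unset Printing Implicit Defensive.

Local Open Scope fset_scope.

Section TeamSemantics.
Variable P : choiceType.

Inductive formula : Type :=
| Sym of P
| NegSym of P
| And of formula & formula
| Or of formula & formula
| Dep of seq P & P
| Anon of seq P & P
  (* [CondIndep ps qs rs]: the qs are independent of the rs given the ps *)
| CondIndep of seq P & seq P & seq P.

Definition Indep (qs rs : seq P) : formula := CondIndep [::] qs rs.

Fixpoint symbols (phi : formula) : {fset P} :=
  match phi with
  | Sym p | NegSym p => [fset p]
  | And phi1 phi2 | Or phi1 phi2 => symbols phi1 `|` symbols phi2
  | Dep ps q | Anon ps q => q |` [fset p in ps]
  | CondIndep ps qs rs => [fset p in ps ++ qs ++ rs]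
  end.

Definition evaluation (V : {fset P}) := {ffun V -> bool}.

Definition team (V : {fset P}) := {set evaluation V}.

(* Symbols outside V get the dummy value false; [equivalent] only considers
   teams whose domain contains all the symbols that occur. *)
Definition value (V : {fset P}) (s : evaluation V) (p : P) : bool :=
  if insub p is Some v then s v else false.

Definition values (V : {fset P}) (s : evaluation V) (ps : seq P) : seq bool :=
  map (value s) ps.

Fixpoint sat (V : {fset P}) (T : team V) (phi : formula) : Prop :=
  match phi with
  | Sym p => forall s, s \in T -> value s p = true
  | NegSym p => forall s, s \in T -> value s p = false
  | And phi1 phi2 => sat T phi1 /\ sat T phi2
  | Or phi1 phi2 => exists S S' : team V,
      [/\ S \subset T, S' \subset T, S :|: S' = T, sat S phi1 & sat S' phi2]
  | Dep ps q => forall s s', s \in T -> s' \in T ->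
      values s ps = values s' ps -> value s q = value s' q
  | Anon ps q => forall s, s \in T -> exists s',
      [/\ s' \in T, values s ps = values s' ps & value s q <> value s' q]
  | CondIndep ps qs rs => forall s s', s \in T -> s' \in T ->
      values s ps = values s' ps -> exists s'',
      [/\ s'' \in T, values s'' ps = values s ps,
          values s'' qs = values s qs & values s'' rs = values s' rs]
  end.

Definition equivalent (phi psi : formula) : Prop :=
  symbols phi = symbols psi /\
  forall (V : {fset P}) (T : team V),
    symbols phi `<=` V -> (sat T phi <-> sat T psi).

End TeamSemantics.

(* Main.v *)
Require Import Defs.
From mathcomp Require Import all_boot finmap.

(** The disjunction [(p /\ phi) \/ (~ p /\ phi)] forces the team to split exactly
    into its subteams [p = 1] and [p = 0], so it says that both satisfy [phi].
    Pairs of evaluations in a common subteam are precisely the pairs that agree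
    on [p]. In (iv), the conjunct [p _|_ qs] replaces [s'] by an evaluation [t]
    that has the same [qs] but lies in the subteam of [s]. *)

Definition case_split {P : choiceType} (p : P) (phi : formula P) : formula P :=
  Or (And (Sym p) phi) (And (NegSym p) phi).

Definition subteam {P : choiceType} {V : {fset P}} (T : team V) (p : P)
    (b : bool) : team V := [set s in T | value s p == b].

Lemma in_subteam {P : choiceType} {V : {fset P}} (T : team V) p b s :
  reflect (s \in T /\ value s p = b) (s \in subteam T p b).
Proof. by rewrite inE; apply: (iffP andP) => -[sT /eqP]. Qed.

Lemma sat_case_split {P : choiceType} {V : {fset P}} (T : team V) p phi :
  sat T (case_split p phi) <-> forall b, sat (subteam T p b) phi.
Proof.
split=> [[S [S' [_ _ <- [Sp Sphi] [S'p S'phi]]]] b | Tphi].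
  (* [Sp] and [S'p] leave no choice of parts: an evaluation of the union with [p] true cannot come
     from [S'], nor one with [p] false from [S]. *)
  have -> : subteam (S :|: S') p b = if b then S else S'.
    apply/setP=> s; apply/in_subteam/idP.
      by case=> /setUP[sS | sS'] <-; [rewrite Sp | rewrite S'p].
    by case: b => sS; split; [rewrite inE sS | exact: Sp
                             | rewrite inE sS orbT | exact: S'p].
  by case: b.
exists (subteam T p true), (subteam T p false); split.
- by apply/subsetP=> s /in_subteam[].
- by apply/subsetP=> s /in_subteam[].
- by apply/setP=> s; rewrite !inE -andb_orr; case: value; rewrite andbT.
- by split; [move=> s /in_subteam[] | exact: Tphi].
- by split; [move=> s /in_subteam[] | exact: Tphi].
Qed.

Lemma values_rcons {P : choiceType} {V : {fset P}} (s s' : evaluation V) ps p :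
  values s (rcons ps p) = values s' (rcons ps p) <->
  values s ps = values s' ps /\ value s p = value s' p.
Proof.
by rewrite /values !map_rcons; split=> [/rcons_inj[-> ->]|[-> ->]].
Qed.

Lemma values1 {P : choiceType} {V : {fset P}} (s s' : evaluation V) p :
  values s [:: p] = values s' [:: p] <-> value s p = value s' p.
Proof. by rewrite /values /=; split=> [[]|->]. Qed.

Lemma dep_rcons {P : choiceType} (ps : seq P) p q :
  equivalent (Dep (rcons ps p) q) (case_split p (Dep ps q)).
Proof.
split.
  apply/fsetP=> x /=; rewrite !inE mem_rcons inE.
  by case: (x == p); case: (x == q); case: (x \in ps).
move=> V T _; rewrite sat_case_split; split=> [Tq b s s' | Tq s s' sT s'T].
  move=> /in_subteam[sT sp] /in_subteam[s'T s'p] eq_ps.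
  by apply: Tq => //; apply/values_rcons; rewrite sp s'p.
case/values_rcons=> eq_ps eq_p.
(* The subteam is the one containing [s]; [eq_p] puts [s'] there too. *)
by apply: (Tq (value s p)) => //; apply/in_subteam.
Qed.

(** A witness for [s] on the left agrees with [s] on [p], hence lies in the same subteam;
    conversely, a witness found inside the subteam of [s] agrees with [s] on [p]. *)
Lemma anon_rcons {P : choiceType} (ps : seq P) p q :
  equivalent (Anon (rcons ps p) q) (case_split p (Anon ps q)).
Proof.
split.
  apply/fsetP=> x /=; rewrite !inE mem_rcons inE.
  by case: (x == p); case: (x == q); case: (x \in ps).
move=> V T _; rewrite sat_case_split; split=> [Tq b s | Tq s sT].
  move=> /in_subteam[/Tq[s' [s'T /values_rcons[eq_ps eq_p] neq_q]] sp].
  by exists s'; split=> //; apply/in_subteam; rewrite -eq_p.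
have /Tq[s' [/in_subteam[s'T s'p] eq_ps neq_q]] : s \in subteam T p (value s p).
  by apply/in_subteam.
by exists s'; split=> //; apply/values_rcons.
Qed.

(** Conditioning on [p] acts twice: as a premise it places [s] and [s'] in one subteam, and as a
    conclusion it keeps [s''] there. *)
Lemma condindep1 {P : choiceType} (p : P) qs rs :
  equivalent (CondIndep [:: p] qs rs) (case_split p (Indep qs rs)).
Proof.
split.
  apply/fsetP=> x /=; rewrite !inE.
  by case: (x == p); case: (x \in qs); case: (x \in rs).
move=> V T _; rewrite sat_case_split; split=> [Tq b s s' | Tq s s' sT s'T].
  move=> /in_subteam[sT sp] /in_subteam[s'T s'p] _.
  have /(Tq _ _ sT s'T)[s'' [s''T /values1 s''p eq_qs eq_rs]] :
    values s [:: p] = values s' [:: p] by apply/values1; rewrite sp.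
  by exists s''; split=> //; apply/in_subteam; rewrite s''p.
move=> /values1 eq_p.
have [||//|s'' [/in_subteam[s''T s''p] _ eq_qs eq_rs]] := Tq (value s p) s s'.
- exact/in_subteam.
- exact/in_subteam.
by exists s''; split=> //; apply/values1.
Qed.

Lemma indep_rcons {P : choiceType} (ps : seq P) p qs :
  equivalent (Indep (rcons ps p) qs)
    (And (Indep [:: p] qs) (case_split p (Indep ps qs))).
Proof.
split.
  apply/fsetP=> x /=; rewrite !inE mem_rcons !inE.
  by case: (x == p); case: (x \in ps); case: (x \in qs).
(* Only the outer conjunction is unfolded, so that [case_split] stays visible to the next
   rewrite. *)
move=> V T _; change (sat T (And ?a ?b)) with (sat T a /\ sat T b).
rewrite sat_case_split; split=> [Tq | [Tp Tq] s s' sT s'T _].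
  split=> [s s' sT s'T _ | b s s' /in_subteam[sT sp] /in_subteam[s'T _] _].
    have [//|s'' [s''T _ /values_rcons[_ eq_p] eq_qs]] := Tq s s' sT s'T.
    by exists s''; split=> //; apply/values1.
  (* Here [s''] copies [p] along with [ps] from [s], so it stays in the subteam of [s]. *)
  have [//|s'' [s''T _ /values_rcons[eq_ps eq_p] eq_qs]] := Tq s s' sT s'T.
  by exists s''; split=> //; apply/in_subteam; rewrite eq_p.
have [//|t [tT _ /values1 tp t_qs]] := Tp s s' sT s'T.
(* Since [t] takes [p] from [s] and [qs] from [s'], independence inside the subteam of [s] applies
   to [s] and [t], and the [qs] obtained from [t] are those of [s']. *)
have [||//|s'' [/in_subteam[s''T s''p] _ eq_ps eq_qs]] := Tq (value s p) s t.
- exact/in_subteam.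
- exact/in_subteam.
by exists s''; split; rewrite ?eq_qs //; apply/values_rcons.
Qed.

Theorem proposition4p1 (P : choiceType) (k n : nat)
    (ps : k.-tuple P) (pk1 q : P) (qs : n.-tuple P) :
  [/\ equivalent (Dep (rcons ps pk1) q)
        (Or (And (Sym pk1) (Dep ps q))
            (And (NegSym pk1) (Dep ps q))),
      equivalent (Anon (rcons ps pk1) q)
        (Or (And (Sym pk1) (Anon ps q))
            (And (NegSym pk1) (Anon ps q))),
      equivalent (CondIndep [:: pk1] ps qs)
        (Or (And (Sym pk1) (Indep ps qs))
            (And (NegSym pk1) (Indep ps qs)))
    & equivalent (Indep (rcons ps pk1) qs)
        (And (Indep [:: pk1] qs)
             (Or (And (Sym pk1) (Indep ps qs))
                 (And (NegSym pk1) (Indep ps qs))))].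
Proof.
split.
- exact: dep_rcons.
- exact: anon_rcons.
- exact: condindep1.
- exact: indep_rcons.
Qed.
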